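(* Let $y>2$ and $m>1$ be natural numbers. Then the algorithm FindFloor2$(y,m)$ (described in the context) determines a natural number $x$ such that $$x=\left\lfloor y^{1/m}\right\rfloor ,$$ i.e. on input $(y,m)$ the algorithm terminates and returns the integer $\lfloor y^{1/m}\rfloor$.
   Context: $\lg$ denotes the logarithm to base two. Initial value: $x_0=2^{\left\lceil (\lfloor\lg y\rfloor+1)/m\right\rceil}$. CheckCandidateSolution$(x,y,m)$ returns YES if $x^m\le y$ and $y<(x+1)^m$, and NO otherwise. Algorithm FindFloor2$(y,m)$: set $i=0$ and $x_0=2^{\left\lceil (\lfloor\lg y\rfloor+1)/m\right\rceil}$. Repeat the following loop. Compute $$x_{i+1}=\left\lfloor\left((m-1)x_i+\left\lfloor\frac{y}{x_i^{m-1}}\right\rfloor\right)\cdot\frac1m\right\rfloor .$$ Case 1: if $x_{i+1}<x_i$, replace $i$ by $i+1$ and continue with the next iteration of the loop. Case 2: if $x_{i+1}\ge x_i$, then return $x_i$ if CheckCandidateSolution$(x_i,y,m)$ is YES. Case 3: if $x_i^m=y$ or $y>x_i^m$, then return $x_i$ if CheckCandidateSolution$(x_i,y,m)$ is YES. *)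

(* Defs.v *)
(* MathComp / MathComp-Analysis. *)
From mathcomp Require Import all_boot all_order all_algebra.
From mathcomp Require Import reals exp.

Set Implicit Arguments.
Unset Strict Implicit.
Unset Printing Implicit Defensive.

Definition lg (R : realType) (a : R) : R := (ln a / ln 2)%R.

(* The exponent ceil ((floor (lg y) + 1) / m) is an integer that is nonnegative
   as soon as y > 0, so `|_|%N only casts it to nat. *)
Definition initial_value (R : realType) (y m : nat) : nat :=
  2 ^ `|Num.ceil (((Num.floor (lg (y%:R : R)) + 1)%:~R / m%:R : R)%R)|%N.

Definition CheckCandidateSolution (x y m : nat) : bool :=
  (x ^ m <= y) && (y < x.+1 ^ m).

(* x_{i+1} as a function of x_i; the floor of a quotient of naturals is %/.
   For positive y and m, a positive x gives a positive result, so the division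
   by zero is never met from [initial_value]. *)
Definition next_value (y m x : nat) : nat :=
  ((m - 1) * x + y %/ x ^ (m - 1)) %/ m.

(* One pass through the body of the loop at x = x_i: [inl r] returns r, [inr x']
   goes on to another pass at x'.  A pass in which no case applies, or whose
   check answers NO, returns nothing and leaves i unchanged, so the loop then
   repeats forever at the same x. *)
Definition loop_body (y m x : nat) : nat + nat :=
  let x' := next_value y m x in
  if x' < x then inr x'
  else if (x' >= x) && CheckCandidateSolution x y m then inl x
  else if ((x ^ m == y) || (y > x ^ m)) && CheckCandidateSolution x y m
  then inl x
  else inr x.

(* At most [k] passes from [x]; None if nothing has been returned by then. *)
Fixpoint run_loop (y m k x : nat) : option nat :=
  if k is k'.+1 then
    match loop_body y m x with
    | inl r => Some r
    | inr x' => run_loop y m k' x'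
    end
  else None.

(* FindFloor2(y, m) terminates and returns r. *)
Definition FindFloor2_returns (R : realType) (y m r : nat) : Prop :=
  exists k : nat, run_loop y m k (initial_value R y m) = Some r.

(* Main.v *)
Require Import Defs.
From mathcomp Require Import all_boot all_order all_algebra.
From mathcomp Require Import reals exp.
From mathcomp Require Import zify.
Import Order.TTheory GRing.Theory Num.Theory.

(** Put F(x) = ((m - 1) x + y / x^(m-1)) / m, the Newton step for the equation
    x^m = y, and let r be the integer m-th root of y.  By the inequality of
    arithmetic and geometric means, applied to m - 1 copies of x and one copy
    of y / x^(m-1), F never falls below the real root of y, and the two floors
    that are taken in the algorithm preserve the lower bound r because r is an
    integer ([leq_next_value]).  Hence every iterate is at least r, provided
    that the first one is; this holds as x_0 is a power of two chosen so that
    y < x_0^m ([initial_value_gt_root]).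

    The loop continues only while the iterates strictly decrease, so it reaches
    some x whose successor is not smaller.  For such an x the Newton step gives
    x <= y / x^(m-1), that is x^m <= y ([root_leq_of_leq_next_value]).  Together
    with r <= x this forces x = r, so the check succeeds and x is returned. *)

(** The inequality of arithmetic and geometric means for n copies of x ^ n.+1
    and one copy of r ^ n.+1, in a form free of roots and divisions.  The
    induction step reduces to 2 r x <= r^2 + x^2, scaled by n.+1 * x ^ n. *)
Lemma leq_AGM_expn n r x : n.+1 * (r * x ^ n) <= n * x ^ n.+1 + r ^ n.+1.
Proof.
elim: n => [|n IHn]; first by rewrite !expn0 expn1; lia.
have sq : 2 * (r * x) <= r ^ 2 + x ^ 2 by rewrite nat_Cauchy.
have {}sq := leq_mul (leqnn (n.+1 * x ^ n)) sq.
have {}IHn := leq_mul (leqnn r) IHn.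
rewrite !expnS in IHn sq *; move: (x ^ n) (r ^ n) IHn sq => a b; nia.
Qed.

(** Multiplying by m * x ^ (m - 1) turns the claim into
    m r x^(m-1) <= (m - 1) x^m + y, which follows from [leq_AGM_expn] as
    r^m <= y; both floors can be removed because r is an integer. *)
Lemma leq_next_value y m x r :
  0 < m -> 0 < x -> r ^ m <= y -> r <= next_value y m x.
Proof.
case: m => // n _ x_gt0 r_le; rewrite /next_value subn1 /= leq_divRL //.
rewrite -leq_subLR leq_divRL ?expn_gt0 ?x_gt0 //.
rewrite mulnBl leq_subLR; apply: leq_trans (leq_add (leqnn _) r_le).
by have := leq_AGM_expn n r x; rewrite expnS; nia.
Qed.

Lemma root_leq_of_leq_next_value y m x :
  0 < m -> 0 < x -> x <= next_value y m x -> x ^ m <= y.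
Proof.
case: m => // n _ x_gt0; rewrite /next_value subn1 /= leq_divRL //.
rewrite [x * _]mulnC mulSn addnC leq_add2l.
by rewrite leq_divRL ?expn_gt0 ?x_gt0 // -expnS.
Qed.

(** The loop invariant is that x is positive and at least the integer m-th
    root of y.  A decreasing step to x' keeps it: if x'.+1 ^ m <= y held,
    [leq_next_value] would give x'.+1 <= x'. *)
Lemma run_loop_returns y m x :
    0 < y -> 0 < m -> 0 < x -> y < x.+1 ^ m ->
  exists r, (exists k, run_loop y m k x = Some r) /\ (r ^ m <= y < r.+1 ^ m).
Proof.
move=> y_gt0 m_gt0; elim/ltn_ind: x => x IHx x_gt0 y_lt.
case: (ltnP (next_value y m x) x) => [x'_lt | x_le].
- have x'_gt0 : 0 < next_value y m x by apply: leq_next_value; rewrite ?exp1n.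
  have y_lt' : y < (next_value y m x).+1 ^ m.
    rewrite ltnNge; apply/negP => /(leq_next_value _ _ _ _ m_gt0 x_gt0).
    by rewrite ltnn.
  have [r [[k run_k] r_root]] := IHx _ x'_lt x'_gt0 y_lt'.
  by exists r; split=> //; exists k.+1; rewrite /= /loop_body x'_lt.
- have x_root : x ^ m <= y < x.+1 ^ m.
    by rewrite root_leq_of_leq_next_value.
  exists x; split=> //; exists 1.
  by rewrite /= /loop_body ltnNge x_le /= /CheckCandidateSolution x_root.
Qed.

(** With c the exponent in x_0 = 2 ^ c, the two roundings give
    lg y < floor (lg y) + 1 <= c * m. *)
Lemma initial_value_gt_root (R : realType) y m :
  0 < y -> 0 < m -> y < initial_value R y m ^ m.
Proof.
move=> y_gt0 m_gt0; rewrite /initial_value.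
set t := (X in Num.ceil X); set c := `|_|%N.
have mR_gt0 : (0 < m%:R :> R)%R by rewrite ltr0n.
have ln2_gt0 : (0 < ln 2 :> R)%R by rewrite ln_gt0 // ltr1n.
have t_le : (t <= c%:R)%R.
  apply: le_trans (ceil_ge t) _.
  by rewrite pmulrn ler_int abszE ler_norm.
have lg_lt : (lg (y%:R : R) < (c * m)%:R)%R.
  apply: lt_le_trans (floorD1_gt _) _.
  by rewrite natrM -ler_pdivrMr.
rewrite -expnM -(ltr_nat R) natrX -ltr_ln ?posrE ?ltr0n ?exprn_gt0 //.
by rewrite lnXn // -[(ln 2 *+ _)%R]mulr_natl -ltr_pdivrMr.
Qed.

Lemma floor_root (R : realType) x y m :
    0 < m -> x ^ m <= y < x.+1 ^ m ->
  (x%:Z = Num.floor ((y%:R : R) `^ (1 / m%:R)))%R.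
Proof.
move=> m_gt0 /andP[x_le x_gt].
have mN0 : (m%:R != 0 :> R)%R by rewrite pnatr_eq0 -lt0n.
set z := (_ `^ _)%R.
have z_ge0 : (0 <= z)%R by apply: powR_ge0.
have zm : (z ^+ m = y%:R)%R.
  by rewrite -powR_mulrn // -powRrM mul1r mulVf // powRr1.
apply/esym/floor_def; rewrite -[(x%:Z + 1)%R]/((x + 1)%N%:Z)%R addn1.
rewrite -!pmulrn -(ler_pXn2r m_gt0) ?nnegrE //.
by rewrite -(ltr_pXn2r m_gt0) ?nnegrE // zm -!natrX ler_nat ltr_nat x_le.
Qed.

Theorem lemma6 (R : realType) (y m : nat) (hy : 2 < y) (hm : 1 < m) :
  exists x : nat,
    FindFloor2_returns R y m x /\
    (x%:Z = Num.floor ((y%:R : R) `^ (1 / m%:R)))%R.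
Proof.
have y_gt0 : 0 < y by apply: ltn_trans hy.
have m_gt0 : 0 < m by apply: ltn_trans hm.
have x0_gt0 : 0 < initial_value R y m by rewrite expn_gt0.
have y_lt : y < (initial_value R y m).+1 ^ m.
  apply: leq_trans (initial_value_gt_root R _ _ y_gt0 m_gt0) _.
  by rewrite leq_exp2r.
have [x [run_x x_root]] := run_loop_returns _ _ _ y_gt0 m_gt0 x0_gt0 y_lt.
by exists x; split=> //; apply: floor_root.
Qed.
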